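(* Let $S$ be a set and $\kappa$ a clock. For every set $X$, the set $(D^\kappa(S\times X))^S$ equipped with $\mathsf{lookup}(x)(s)=x\,s\,s$ for $x:((D^\kappa(S\times X))^S)^S$, $\mathsf{update}(x)=\lambda s.\lambda s'.\,x\,s$ for $x:(D^\kappa(S\times X))^S$, $\mathsf{step}(x)=\lambda s.\,\mathsf{step}^\kappa(\lambda(\alpha{:}\kappa).\,(x[\alpha])\,s)$ for $x:\triangleright^\kappa((D^\kappa(S\times X))^S)$, and the map $\eta(x)=\lambda s.\,\mathsf{now}^\kappa(s,x)$, is the free GSD-algebra on $X$: for every GSD-algebra $Y$ and every map $f:X\to Y$ there is a unique GSD-algebra homomorphism $\bar f:(D^\kappa(S\times X))^S\to Y$ with $\bar f\circ\eta=f$. Consequently the monad $(D^\kappa(S\times -))^S$ is the free model monad of the theory of GSD-algebras.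
   Context: We work in Clocked Cubical Type Theory with a clock $\kappa$ and later modality $\triangleright^\kappa$: elements of $\triangleright^\kappa A$ are built by tick abstraction $\lambda(\alpha{:}\kappa).t$ and used by tick application $t[\alpha]$; guarded recursion via $\mathsf{fix}:(\triangleright^\kappa A\to A)\to A$ with $\mathsf{fix}(f)=f(\lambda(\alpha{:}\kappa).\mathsf{fix}(f))$. ''Set'' means clock-irrelevant homotopy set. $D^\kappa X\simeq X+\triangleright^\kappa(D^\kappa X)$ is the guarded delay monad with $\mathsf{now}^\kappa:X\to D^\kappa X$, $\mathsf{step}^\kappa:\triangleright^\kappa(D^\kappa X)\to D^\kappa X$. A GS-algebra is a set $X$ with $\mathsf{lookup}:X^S\to X$ and $\mathsf{update}:X\to X^S$ satisfying: $\mathsf{lookup}(\lambda s.\mathsf{lookup}(f s))=\mathsf{lookup}(\lambda s.f\,s\,s)$ for $f:(X^S)^S$; $\mathsf{lookup}(\mathsf{update}\,x)=x$; $\mathsf{update}(\mathsf{lookup}\,g)\,s=\mathsf{update}(g\,s)\,s$ for $g:X^S$, $s:S$; $\mathsf{update}((\mathsf{update}\,x)\,s)\,t=(\mathsf{update}\,x)\,s$. A GSD-algebra is a GS-algebra with additionally a map $\mathsf{step}:\triangleright^\kappa X\to X$ such that $\mathsf{step}(\lambda(\alpha{:}\kappa).\mathsf{lookup}(d[\alpha]))=\mathsf{lookup}(\lambda s.\mathsf{step}(\lambda(\alpha{:}\kappa).d[\alpha]\,s))$ for $d:\triangleright^\kappa(X^S)$, and $\mathsf{update}(\mathsf{step}\,x)\,s=\mathsf{step}(\lambda(\alpha{:}\kappa).\mathsf{update}(x[\alpha])\,s)$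 for $x:\triangleright^\kappa X$, $s:S$. Homomorphisms preserve $\mathsf{lookup}$, $\mathsf{update}$ and $\mathsf{step}$ (the latter as $h(\mathsf{step}(x))=\mathsf{step}(\lambda(\alpha{:}\kappa).h(x[\alpha]))$). *)

(* Defs.v *)
(* The statement is a theorem of Clocked Cubical Type Theory; it is formulated
   here for an arbitrary category with the structure that the type theory gives
   to its category of sets.  In any context, the clock-irrelevant sets and the
   terms between them, up to path equality, form a category with finite limits,
   exponentials (function types) and binary sums, and each clock k gives an
   operation [later k] that commutes with finite limits and has a guarded fixed
   point operator.  The record [guarded_category] is this structure.  The topos
   of trees and the presheaf models over several clocks are further instances.

   Objects are the sets of the ambient context.  A morphism [hom G A] is a term
   of type A in the ambient context extended by G; a universally quantified
   variable of type A is a term [hom G A] for an arbitrary G, and the application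
   of a closed function [m : hom A B] to a term t is [m ∘ t]. *)

Set Implicit Arguments.
Unset Strict Implicit.
Unset Printing Implicit Defensive.

Record category := Category {
  ob :> Type;
  hom : ob -> ob -> Type;
  idm : forall A, hom A A;
  comp : forall A B C, hom B C -> hom A B -> hom A C;
  comp_idl : forall A B (f : hom A B), comp (idm B) f = f;
  comp_idr : forall A B (f : hom A B), comp f (idm A) = f;
  comp_assoc : forall A B C D (h : hom C D) (g : hom B C) (f : hom A B),
    comp h (comp g f) = comp (comp h g) f
}.

Arguments hom {_}.
Arguments idm {_}.
Arguments comp {_ _ _ _}.

Declare Scope term_scope.
Delimit Scope term_scope with term.
Open Scope term_scope.

Notation "g ∘ f" := (comp g f) (at level 40, left associativity) : term_scope.

Definition is_terminal (C : category) (T : C) : Prop :=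
  forall G : C, exists! t : hom G T, True.

Definition is_equalizer (C : category) (E A B : C)
    (e : hom E A) (f g : hom A B) : Prop :=
  f ∘ e = g ∘ e /\
  forall (G : C) (h : hom G A), f ∘ h = g ∘ h -> exists! k : hom G E, e ∘ k = h.

Record set_category := SetCategory {
  cat_of :> category;
  unit_ob : cat_of;
  unit_terminal : is_terminal unit_ob;
  prod_ob : cat_of -> cat_of -> cat_of;
  pairing : forall G A B : cat_of, hom G A -> hom G B -> hom G (prod_ob A B);
  p1 : forall A B : cat_of, hom (prod_ob A B) A;
  p2 : forall A B : cat_of, hom (prod_ob A B) B;
  p1_pairing : forall (G A B : cat_of) (t : hom G A) (u : hom G B),
    p1 A B ∘ pairing t u = t;
  p2_pairing : forall (G A B : cat_of) (t : hom G A) (u : hom G B),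
    p2 A B ∘ pairing t u = u;
  pairing_eta : forall (G A B : cat_of) (t : hom G (prod_ob A B)),
    pairing (p1 A B ∘ t) (p2 A B ∘ t) = t;
  has_equalizers : forall (A B : cat_of) (f g : hom A B),
    exists (E : cat_of) (e : hom E A), is_equalizer e f g;
  exp_ob : cat_of -> cat_of -> cat_of;
  ev : forall A B : cat_of, hom (prod_ob (exp_ob A B) A) B;
  lam : forall G A B : cat_of, hom (prod_ob G A) B -> hom G (exp_ob A B);
  ev_lam : forall (G A B : cat_of) (t : hom (prod_ob G A) B),
    ev A B ∘ pairing (lam t ∘ p1 G A) (p2 G A) = t;
  lam_eta : forall (G A B : cat_of) (t : hom G (exp_ob A B)),
    lam (ev A B ∘ pairing (t ∘ p1 G A) (p2 G A)) = t;
  sum_ob : cat_of -> cat_of -> cat_of;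
  inj1 : forall A B : cat_of, hom A (sum_ob A B);
  inj2 : forall A B : cat_of, hom B (sum_ob A B);
  copair : forall A B X : cat_of, hom A X -> hom B X -> hom (sum_ob A B) X;
  copair_inj1 : forall (A B X : cat_of) (l : hom A X) (r : hom B X),
    copair l r ∘ inj1 A B = l;
  copair_inj2 : forall (A B X : cat_of) (l : hom A X) (r : hom B X),
    copair l r ∘ inj2 A B = r;
  copair_eta : forall (A B X : cat_of) (t : hom (sum_ob A B) X),
    copair (t ∘ inj1 A B) (t ∘ inj2 A B) = t
}.

Arguments pairing {_ _ _ _}.
Arguments p1 {_ _ _}.
Arguments p2 {_ _ _}.
Arguments ev {_ _ _}.
Arguments lam {_ _ _ _}.
Arguments inj1 {_ _ _}.
Arguments inj2 {_ _ _}.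
Arguments copair {_ _ _ _}.

Notation "A × B" := (prod_ob A B) (at level 40, left associativity) : term_scope.
Notation "A ⊕ B" := (sum_ob A B) (at level 50, left associativity) : term_scope.
Notation "A ⇒ B" := (exp_ob A B) (at level 55, right associativity) : term_scope.
Notation "⟨ t , u ⟩" := (pairing t u) (format "⟨ t ,  u ⟩") : term_scope.

Section Terms.
Context {C : set_category}.

(* Terms use de Bruijn indices: [v0] is the last variable of the context. *)
Definition v0 {G A : C} : hom (G × A) A := p2.
Definition wk {G A B : C} (t : hom G B) : hom (G × A) B := t ∘ p1.

Definition app {G A B : C} (t : hom G (A ⇒ B)) (u : hom G A) : hom G B :=
  ev ∘ ⟨t, u⟩.

(* match t with inj1 a => l | inj2 b => r end *)
Definition case {G A B X : C} (t : hom G (A ⊕ B))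
    (l : hom (G × A) X) (r : hom (G × B) X) : hom G X :=
  app (copair (lam (l ∘ ⟨p2, p1⟩)) (lam (r ∘ ⟨p2, p1⟩)) ∘ t) (idm G).

End Terms.

(* Tick abstraction and application are expressed by combinators:
   [lmap m ∘ x] is λα. m (x[α]), [next ∘ x] is λα. x, and [lpair ∘ ⟨x, y⟩] is
   λα. (x[α], y[α]).  The fields [later_terminal], [lpairK], [lpairVK] and
   [later_equalizer] say that later preserves finite limits. *)
Record later_modality (C : set_category) := LaterModality {
  later : C -> C;
  lmap : forall A B : C, hom A B -> hom (later A) (later B);
  lmap_id : forall A : C, lmap (idm A) = idm (later A);
  lmap_comp : forall (A B X : C) (g : hom B X) (f : hom A B),
    lmap (g ∘ f) = lmap g ∘ lmap f;
  next : forall A : C, hom A (later A);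
  next_natural : forall (A B : C) (f : hom A B), next B ∘ f = lmap f ∘ next A;
  later_terminal : is_terminal (later (unit_ob C));
  lpair : forall A B : C, hom (later A × later B) (later (A × B));
  lpairK : forall A B : C,
    ⟨lmap (@p1 C A B), lmap (@p2 C A B)⟩ ∘ lpair A B = idm (later A × later B);
  lpairVK : forall A B : C,
    lpair A B ∘ ⟨lmap (@p1 C A B), lmap (@p2 C A B)⟩ = idm (later (A × B));
  later_equalizer : forall (E A B : C) (e : hom E A) (f g : hom A B),
    is_equalizer e f g -> is_equalizer (lmap e) (lmap f) (lmap g);
  (* fix : (later A -> A) -> A  with  fix f = f (λα. fix f) *)
  gfix : forall A : C, hom (later A ⇒ A) A;
  gfixE : forall (G A : C) (f : hom G (later A ⇒ A)),
    gfix A ∘ f = app f (next A ∘ (gfix A ∘ f))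
}.

Arguments later {_}.
Arguments lmap {_} _ {_ _}.
Arguments next {_} _ {_}.
Arguments lpair {_} _ {_ _}.
Arguments gfix {_} _ {_}.

Record guarded_category := GuardedCategory {
  sets :> set_category;
  clock : Type;
  later_at : forall k : clock, later_modality sets
}.

(* λα. f[α] (x[α]) *)
Definition lapp {C : set_category} (L : later_modality C) {G A B : C}
    (f : hom G (later L (A ⇒ B))) (x : hom G (later L A)) : hom G (later L B) :=
  lmap L ev ∘ (lpair L ∘ ⟨f, x⟩).

(* The guarded recursive types D X ≃ X + later (D X). *)
Record guarded_delay (C : set_category) (L : later_modality C) := GuardedDelay {
  delay : C -> C;
  now : forall X : C, hom X (delay X);
  dstep : forall X : C, hom (later L (delay X)) (delay X);
  dout : forall X : C, hom (delay X) (X ⊕ later L (delay X));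
  doutK : forall X : C, copair (now X) (dstep X) ∘ dout X = idm (delay X);
  doutVK : forall X : C,
    dout X ∘ copair (now X) (dstep X) = idm (X ⊕ later L (delay X))
}.

Arguments delay {_ _}.
Arguments now {_ _} _ {_}.
Arguments dstep {_ _} _ {_}.
Arguments dout {_ _} _ {_}.

Section DelayMonad.
Context {C : set_category} {L : later_modality C} (D : guarded_delay L).

(* The Kleisli extension of D, by guarded recursion:
   λf. fix (λr. λd. match d with
                    | now a => f a
                    | step d' => step (λα. r[α] (d'[α])) end).
   The context of the branches is f, r, d and then a or d'. *)
Definition delay_bind {A B : C} :
    hom (A ⇒ delay D B) (delay D A ⇒ delay D B) :=
  gfix L ∘ lam (lam (case (dout D ∘ v0)
    (app (wk (wk (wk (idm (A ⇒ delay D B))))) v0)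
    (dstep D ∘ lapp (wk (wk v0)) v0))).

End DelayMonad.

Section GSDAlgebras.
Context {C : set_category} (L : later_modality C) (S : C).

Record gsd_ops (X : C) := GsdOps {
  lookup : hom (S ⇒ X) X;
  update : hom X (S ⇒ X);
  step : hom (later L X) X
}.

Arguments lookup {_}.
Arguments update {_}.
Arguments step {_}.

Record gsd_laws (X : C) (o : gsd_ops X) : Prop := GsdLaws {
  (* lookup (λs. lookup (f s)) = lookup (λs. f s s) *)
  lookup_lookup : forall (G : C) (f : hom G (S ⇒ S ⇒ X)),
    lookup o ∘ lam (lookup o ∘ app (wk f) v0)
    = lookup o ∘ lam (app (app (wk f) v0) v0);
  lookup_update : forall (G : C) (x : hom G X),
    lookup o ∘ (update o ∘ x) = x;
  update_lookup : forall (G : C) (g : hom G (S ⇒ X)) (s : hom G S),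
    app (update o ∘ (lookup o ∘ g)) s = app (update o ∘ app g s) s;
  update_update : forall (G : C) (x : hom G X) (s t : hom G S),
    app (update o ∘ app (update o ∘ x) s) t = app (update o ∘ x) s;
  (* step (λα. lookup (d[α])) = lookup (λs. step (λα. d[α] s)) *)
  step_lookup : forall (G : C) (d : hom G (later L (S ⇒ X))),
    step o ∘ (lmap L (lookup o) ∘ d)
    = lookup o ∘ lam (step o ∘ lapp (wk d) (next L ∘ v0));
  (* update (step x) s = step (λα. update (x[α]) s) *)
  update_step : forall (G : C) (x : hom G (later L X)) (s : hom G S),
    app (update o ∘ (step o ∘ x)) s
    = step o ∘ lapp (lmap L (update o) ∘ x) (next L ∘ s)
}.

Record gsd_algebra := GsdAlgebra {
  carrier :> C;
  ops : gsd_ops carrier;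
  laws : gsd_laws ops
}.

(* [h : X -> Y] is a homomorphism, for h a term of function type in context G;
   [w] is the weakening to a further context. *)
Record is_gsd_hom (X Y : C) (oX : gsd_ops X) (oY : gsd_ops Y)
    (G : C) (h : hom G (X ⇒ Y)) : Prop := IsGsdHom {
  hom_lookup : forall (G' : C) (w : hom G' G) (g : hom G' (S ⇒ X)),
    app (h ∘ w) (lookup oX ∘ g)
    = lookup oY ∘ lam (app (wk (h ∘ w)) (app (wk g) v0));
  hom_update : forall (G' : C) (w : hom G' G) (x : hom G' X) (s : hom G' S),
    app (h ∘ w) (app (update oX ∘ x) s)
    = app (update oY ∘ app (h ∘ w) x) s;
  (* h (step x) = step (λα. h (x[α])) *)
  hom_step : forall (G' : C) (w : hom G' G) (x : hom G' (later L X)),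
    app (h ∘ w) (step oX ∘ x) = step oY ∘ lapp (next L ∘ (h ∘ w)) x
}.

(* [h : F -> Y] is a homomorphism with h ∘ eta = f. *)
Definition is_gsd_extension (X F Y : C) (oF : gsd_ops F) (eta : hom X F)
    (oY : gsd_ops Y) (G : C) (f : hom G (X ⇒ Y)) (h : hom G (F ⇒ Y)) : Prop :=
  is_gsd_hom oF oY h /\
  forall (G' : C) (w : hom G' G) (x : hom G' X),
    app (h ∘ w) (eta ∘ x) = app (f ∘ w) x.

(* Freeness in the internal sense: f : X -> Y ranges over terms of function type
   in every context.  For G the terminal object this is the external universal
   property. *)
Definition is_free_gsd (X F : C) (oF : gsd_ops F) (eta : hom X F) : Prop :=
  gsd_laws oF /\
  forall (Y : gsd_algebra) (G : C) (f : hom G (X ⇒ Y)),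
    exists! h : hom G (F ⇒ Y), is_gsd_extension oF eta (ops Y) f h.

End GSDAlgebras.

Section Monads.
Context {C : set_category}.

Record kleisli_triple := KleisliTriple {
  monad_ob :> C -> C;
  ret : forall X : C, hom X (monad_ob X);
  bind : forall X Y : C, hom (X ⇒ monad_ob Y) (monad_ob X ⇒ monad_ob Y)
}.

Arguments ret _ {_}.
Arguments bind _ {_ _}.

Record is_monad (M : kleisli_triple) : Prop := IsMonad {
  bind_ret : forall (X Y G : C) (k : hom G (X ⇒ M Y)) (x : hom G X),
    app (bind M ∘ k) (ret M ∘ x) = app k x;
  ret_bind : forall (X G : C) (m : hom G (M X)),
    app (bind M ∘ lam (ret M ∘ v0)) m = m;
  bind_bind : forall (X Y Z G : C) (k : hom G (X ⇒ M Y)) (l : hom G (Y ⇒ M Z))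
      (m : hom G (M X)),
    app (bind M ∘ l) (app (bind M ∘ k) m)
    = app (bind M ∘ lam (app (bind M ∘ wk l) (app (wk k) v0))) m
}.

(* M is the monad of the free-forgetful adjunction of GSD-algebras, where the
   free algebra on X is M X with the operations [oM X]: its unit is the
   insertion of generators, and the Kleisli extension of k : X -> M Y is the
   homomorphic extension of k. *)
Definition is_free_model_monad (L : later_modality C) (S : C)
    (M : kleisli_triple) (oM : forall X : C, gsd_ops L S (M X)) : Prop :=
  is_monad M /\
  (forall X : C, is_free_gsd (oM X) (@ret M X)) /\
  (forall (X Y G : C) (k : hom G (X ⇒ M Y)),
     is_gsd_extension (oM X) (@ret M X) (oM Y) k (bind M ∘ k)).

End Monads.

Arguments is_free_model_monad {C L S}.

Section StateDelay.
Context {C : set_category} {L : later_modality C} (D : guarded_delay L) (S : C).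

Definition state_delay (X : C) : C := S ⇒ delay D (S × X).

(* lookup x = λs. x s s,  update x = λs. λs'. x s,
   step x = λs. step (λα. x[α] s) *)
Definition state_delay_ops (X : C) : gsd_ops L S (state_delay X) :=
  {| lookup := lam (app (app (wk (idm (S ⇒ state_delay X))) v0) v0);
     update := lam (lam (app (wk (wk (idm (state_delay X)))) (wk v0)));
     step := lam (dstep D ∘
       lapp (wk (idm (later L (state_delay X)))) (next L ∘ v0)) |}.

(* λs. now (s, x) *)
Definition state_delay_ret (X : C) : hom X (state_delay X) :=
  lam (now D ∘ ⟨v0, wk (idm X)⟩).

(* The state monad transformer applied to D:
   λk. λm. λs. delay_bind (λp. k (p.2) (p.1)) (m s) *)
Definition state_delay_bind (X Y : C) :
    hom (X ⇒ state_delay Y) (state_delay X ⇒ state_delay Y) :=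
  lam (lam (app
    (delay_bind D ∘
       lam (app (app (wk (wk (wk (idm (X ⇒ state_delay Y))))) (p2 ∘ v0))
                (p1 ∘ v0)))
    (app (wk v0) v0))).

Definition state_delay_monad : kleisli_triple :=
  {| monad_ob := state_delay;
     ret := state_delay_ret;
     bind := state_delay_bind |}.

End StateDelay.

(* Main.v *)
(** A guarded fixed point of [later L T -> T] exists in particular for
    subterminal [T]; this gives induction under [later] for equations between
    terms, hence uniqueness of the maps out of [delay D A] that are determined on
    [now] and [dstep].

    Given [f : X -> Y], let [g : delay D (S × X) -> Y] be the map with
    g (now (s, x)) = update (f x) s and g (step d) = step (λα. g (d[α])).  The
    extension of [f] is h m = lookup (λs. g (m s)).  It preserves [update] because
    update (g d) s = g d, by the induction principle.  Conversely, every extension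
    [h] satisfies h m = lookup (λs. h (λs'. m s)), since m = lookup (λs. λs'. m s)
    holds in the free algebra, and d ↦ h (λs'. d) satisfies the equations of [g].
    The monad laws are instances of this uniqueness. *)

From Stdlib Require Import Setoid.
Require Import Defs.

Set Implicit Arguments.
Unset Strict Implicit.

(** * Substitution and extensionality rules for terms *)

Section Calculus.
Context {C : set_category}.

Lemma pairing_comp (G H A B : C) (t : hom G A) (u : hom G B) (w : hom H G) :
  ⟨t, u⟩ ∘ w = ⟨t ∘ w, u ∘ w⟩.
Proof.
  rewrite <- (pairing_eta (⟨t, u⟩ ∘ w)), !comp_assoc, p1_pairing, p2_pairing.
  reflexivity.
Qed.

Lemma pairing_p1_p2 (A B : C) : ⟨p1, p2⟩ = idm (A × B).
Proof. rewrite <- (pairing_eta (idm (A × B))), !comp_idr. reflexivity. Qed.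

Lemma app_comp (G H A B : C) (t : hom G (A ⇒ B)) (u : hom G A) (w : hom H G) :
  app t u ∘ w = app (t ∘ w) (u ∘ w).
Proof. unfold app. rewrite <- comp_assoc, pairing_comp. reflexivity. Qed.

Lemma app_lam_comp (G H A B : C) (t : hom (G × A) B) (w : hom H G) (u : hom H A) :
  app (lam t ∘ w) u = t ∘ ⟨w, u⟩.
Proof.
  rewrite <- (ev_lam t) at 2. unfold app.
  rewrite <- comp_assoc, pairing_comp, <- comp_assoc, p1_pairing, p2_pairing.
  reflexivity.
Qed.

Lemma app_lam (G A B : C) (t : hom (G × A) B) (u : hom G A) :
  app (lam t) u = t ∘ ⟨idm G, u⟩.
Proof. rewrite <- app_lam_comp, comp_idr. reflexivity. Qed.

Lemma lam_ext (G A B : C) (t u : hom G (A ⇒ B)) :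
  app (t ∘ p1) p2 = app (u ∘ p1) p2 -> t = u.
Proof.
  unfold app. intros E. rewrite <- (lam_eta t), <- (lam_eta u), E. reflexivity.
Qed.

Lemma lam_comp (G H A B : C) (t : hom (G × A) B) (w : hom H G) :
  lam t ∘ w = lam (t ∘ ⟨w ∘ p1, p2⟩).
Proof.
  apply lam_ext. rewrite <- comp_assoc, !app_lam_comp.
  rewrite <- comp_assoc, pairing_comp, <- comp_assoc, p1_pairing, p2_pairing.
  reflexivity.
Qed.

Lemma lam_app (G A B : C) (t : hom G (A ⇒ B)) : lam (app (t ∘ p1) p2) = t.
Proof. apply lam_eta. Qed.

Lemma copair_ext (A B X : C) (t u : hom (A ⊕ B) X) :
  t ∘ inj1 = u ∘ inj1 -> t ∘ inj2 = u ∘ inj2 -> t = u.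
Proof.
  intros E1 E2. rewrite <- (copair_eta t), <- (copair_eta u), E1, E2. reflexivity.
Qed.

End Calculus.

Lemma comp_assoc_r (C : category) (A B X Y : C) (h : hom X Y) (g : hom B X) (f : hom A B) :
  (h ∘ g) ∘ f = h ∘ (g ∘ f).
Proof. symmetry. apply comp_assoc. Qed.

(* Substitutions are pushed inwards as in the λσ-calculus, and terms built from
   [lmap], [lapp] and [next] with one delayed variable become an [ltick]. *)
Create HintDb term.
Hint Rewrite @comp_assoc_r @comp_idl @comp_idr @p1_pairing @p2_pairing
  @pairing_comp @pairing_p1_p2 @app_comp @app_lam @lam_comp @lam_app
  @pairing_eta : term.

Ltac norm := unfold wk, v0 in *; autorewrite with term.

(** * Delayed terms and induction under [later] *)

Section Later.
Context {C : set_category} (L : later_modality C).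

Lemma lmap_p1_lpair (G A B : C) (t : hom G (later L A)) (u : hom G (later L B)) :
  lmap L p1 ∘ (lpair L ∘ ⟨t, u⟩) = t.
Proof.
  assert (E := f_equal (comp p1) (lpairK L A B)). norm.
  autorewrite with term in E.
  rewrite comp_assoc, E. norm. reflexivity.
Qed.

Lemma lmap_p2_lpair (G A B : C) (t : hom G (later L A)) (u : hom G (later L B)) :
  lmap L p2 ∘ (lpair L ∘ ⟨t, u⟩) = u.
Proof.
  assert (E := f_equal (comp p2) (lpairK L A B)). norm.
  autorewrite with term in E.
  rewrite comp_assoc, E. norm. reflexivity.
Qed.

Lemma lpair_lmap (G X A B : C) (f : hom X A) (g : hom X B) (c : hom G (later L X)) :
  lpair L ∘ ⟨lmap L f ∘ c, lmap L g ∘ c⟩ = lmap L ⟨f, g⟩ ∘ c.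
Proof.
  rewrite <- (comp_idl (lmap L ⟨f, g⟩)), <- lpairVK. norm.
  rewrite !(comp_assoc (lmap L _) (lmap L _)), <- !lmap_comp. norm. reflexivity.
Qed.

(* [T] is the object of sections of the equalizer E -> Q of x and y; the
   hypothesis says that a delayed section yields a section, so that [gfix]
   produces an element of [T]. *)
Lemma loeb (Q A : C) (x y : hom Q A) :
  (forall (G : C) (w : hom G Q),
     next L ∘ (x ∘ w) = next L ∘ (y ∘ w) -> x ∘ w = y ∘ w) ->
  x = y.
Proof.
  intros H.
  destruct (has_equalizers x y) as (E & e & Exy & Euniv).
  (* The equalizer condition on s in [Q ⇒ E] is λq. e (s q) = λq. q, so [T] collects the sections of
     [e]. *)
  destruct (has_equalizers (lam (e ∘ app p1 p2)) (lam (p2 (A := Q ⇒ E) (B := Q))))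
    as (T & i & Ti & Tuniv).
  assert (He : e ∘ app (i ∘ p1) p2 = p2 (A := T) (B := Q)).
  { assert (K := f_equal (fun t => app (t ∘ p1) (p2 (A := T) (B := Q))) Ti).
    cbn beta in K. autorewrite with term in K. exact K. }
  destruct (Euniv _ (p2 (A := later L T) (B := Q))) as (r & Hr & _).
  { apply H. rewrite !comp_assoc, !next_natural, <- !comp_assoc.
    (* A delayed section applied to [next q] is a delayed element of [E] lying over [next q];
       [lmap x] and [lmap y] agree on its image. *)
    assert (Z : lmap L e ∘ (lmap L (app (i ∘ p1) p2) ∘ (lpair L ∘ ⟨p1, next L ∘ p2⟩))
            = next L ∘ p2 (A := later L T) (B := Q)).
    { rewrite comp_assoc, <- lmap_comp, He. apply lmap_p2_lpair. }
    rewrite <- Z, !(comp_assoc (lmap L _) (lmap L e)), <- !lmap_comp, Exy.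
    reflexivity. }
  (* [lam r] is again a section of [e], so it factors through a map [st] from [later L T] to [T]. *)
  destruct (Tuniv _ (lam r)) as (st & _ & _).
  { norm. rewrite Hr. reflexivity. }
  set (t := gfix L ∘ lam (st ∘ p2) : hom Q T).
  assert (K : e ∘ app (i ∘ t) (idm Q) = idm Q).
  { assert (K := f_equal (fun u => u ∘ ⟨t, idm Q⟩) He).
    cbn beta in K. autorewrite with term in K. exact K. }
  rewrite <- (comp_idr x), <- (comp_idr y), <- K, !comp_assoc, Exy. reflexivity.
Qed.

(* λα. t (x[α]) for a term t of context G × A *)
Definition ltick {G A B : C} (t : hom (G × A) B) (x : hom G (later L A)) :
    hom G (later L B) :=
  lmap L t ∘ (lpair L ∘ ⟨next L, x⟩).

Lemma ltick_comp (G H A B : C) (t : hom (G × A) B) (x : hom G (later L A))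
    (w : hom H G) :
  ltick t x ∘ w = ltick (t ∘ ⟨w ∘ p1, p2⟩) (x ∘ w).
Proof.
  unfold ltick. norm. rewrite next_natural, lmap_comp, <- comp_assoc. f_equal.
  rewrite <- lpair_lmap, lmap_comp, <- comp_assoc, lmap_p1_lpair, lmap_p2_lpair.
  reflexivity.
Qed.

Lemma lmap_ltick (G A B X : C) (m : hom B X) (t : hom (G × A) B)
    (x : hom G (later L A)) :
  lmap L m ∘ ltick t x = ltick (m ∘ t) x.
Proof. unfold ltick. rewrite comp_assoc, <- lmap_comp. reflexivity. Qed.

Lemma ltick_p2 (G A : C) (x : hom G (later L A)) : ltick p2 x = x.
Proof. apply lmap_p2_lpair. Qed.

Lemma lmap_as_ltick (G A B : C) (m : hom A B) (x : hom G (later L A)) :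
  lmap L m ∘ x = ltick (m ∘ p2) x.
Proof. rewrite <- lmap_ltick, ltick_p2. reflexivity. Qed.

Lemma ltick_const (G A B : C) (u : hom G B) (x : hom G (later L A)) :
  ltick (u ∘ p1) x = next L ∘ u.
Proof.
  unfold ltick. rewrite lmap_comp, <- comp_assoc, lmap_p1_lpair, next_natural.
  reflexivity.
Qed.

Lemma lpair_ltick (G A B X : C) (t : hom (G × A) B) (u : hom (G × A) X)
    (x : hom G (later L A)) :
  lpair L ∘ ⟨ltick t x, ltick u x⟩ = ltick ⟨t, u⟩ x.
Proof. apply lpair_lmap. Qed.

Lemma ltick_ltick (G A B X : C) (t : hom (G × B) X) (u : hom (G × A) B)
    (x : hom G (later L A)) :
  ltick t (ltick u x) = ltick (t ∘ ⟨p1, u⟩) x.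
Proof.
  (* [next L] is itself a constant [ltick] over [x], so both components of the pair are delayed in
     the same variable. *)
  unfold ltick at 1. rewrite <- (comp_idr (next L)), <- (ltick_const _ x), lpair_ltick,
    lmap_ltick, comp_idl. reflexivity.
Qed.

Lemma lapp_ltick (G A B X : C) (t : hom (G × A) (B ⇒ X)) (u : hom (G × A) B)
    (x : hom G (later L A)) :
  lapp (ltick t x) (ltick u x) = ltick (app t u) x.
Proof. unfold lapp. rewrite lpair_ltick, lmap_ltick. reflexivity. Qed.

Lemma lapp_next_l (G A B : C) (f : hom G (A ⇒ B)) (x : hom G (later L A)) :
  lapp (next L ∘ f) x = ltick (app (f ∘ p1) p2) x.
Proof. rewrite <- lapp_ltick, ltick_const, ltick_p2. reflexivity. Qed.

Lemma lapp_next_r (G A B : C) (f : hom G (later L (A ⇒ B))) (u : hom G A) :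
  lapp f (next L ∘ u) = ltick (app p2 (u ∘ p1)) f.
Proof. rewrite <- lapp_ltick, ltick_const, ltick_p2. reflexivity. Qed.

Lemma lapp_comp (G H A B : C) (f : hom G (later L (A ⇒ B))) (x : hom G (later L A))
    (w : hom H G) :
  lapp f x ∘ w = lapp (f ∘ w) (x ∘ w).
Proof. unfold lapp. norm. reflexivity. Qed.

End Later.

Hint Rewrite @ltick_comp @lapp_comp @lmap_ltick @lmap_as_ltick @ltick_ltick
  @ltick_p2 @lapp_next_l @lapp_next_r : term.

(** * Recursion and uniqueness for maps out of the delay type *)

Section Delay.
Context {C : set_category} {L : later_modality C} (D : guarded_delay L).

(** The scrutinee has to be an injection only after the substitution [w], so the rule also applies
    to a [case] on a variable that [w] instantiates. *)
Lemma case_inj1 (G H A B X : C) (t : hom G (A ⊕ B)) (l : hom (G × A) X)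
    (r : hom (G × B) X) (w : hom H G) (a : hom H A) :
  t ∘ w = inj1 ∘ a -> case t l r ∘ w = l ∘ ⟨w, a⟩.
Proof.
  intros E. unfold case. norm. rewrite E, (comp_assoc (copair _ _)), copair_inj1.
  rewrite app_lam_comp. norm. reflexivity.
Qed.

Lemma case_inj2 (G H A B X : C) (t : hom G (A ⊕ B)) (l : hom (G × A) X)
    (r : hom (G × B) X) (w : hom H G) (b : hom H B) :
  t ∘ w = inj2 ∘ b -> case t l r ∘ w = r ∘ ⟨w, b⟩.
Proof.
  intros E. unfold case. norm. rewrite E, (comp_assoc (copair _ _)), copair_inj2.
  rewrite app_lam_comp. norm. reflexivity.
Qed.

Lemma dout_now (A : C) : dout D ∘ now D = inj1 (A := A).
Proof. rewrite <- (copair_inj1 (now D) (dstep D)), comp_assoc, doutVK. apply comp_idl. Qed.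

Lemma dout_dstep (A : C) : dout D ∘ dstep D = inj2 (A := A).
Proof. rewrite <- (copair_inj2 (now D) (dstep D)), comp_assoc, doutVK. apply comp_idl. Qed.

Lemma delay_ext (A Z : C) (t u : hom (delay D A) Z) :
  t ∘ now D = u ∘ now D -> t ∘ dstep D = u ∘ dstep D -> t = u.
Proof.
  intros En Es. rewrite <- (comp_idr t), <- (comp_idr u), <- doutK, !comp_assoc.
  f_equal. apply copair_ext; rewrite <- !comp_assoc, ?copair_inj1, ?copair_inj2; assumption.
Qed.

(** Swapping the context with the argument and currying the context turns both terms into maps out
    of [delay D A] alone, to which [delay_ext] applies. *)
Lemma delay_fun_ext (G A Z : C) (t u : hom G (delay D A ⇒ Z)) :
  app (t ∘ p1) (now D ∘ p2) = app (u ∘ p1) (now D ∘ p2) ->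
  app (t ∘ p1) (dstep D ∘ p2) = app (u ∘ p1) (dstep D ∘ p2) ->
  t = u.
Proof.
  intros En Es. apply lam_ext.
  assert (E : lam (app (t ∘ p2) p1) = lam (app (u ∘ p2) (p1 (A := delay D A)))).
  { apply delay_ext; norm; f_equal.
    - assert (E := f_equal (fun v => v ∘ ⟨p2, p1⟩) En).
      cbn beta in E. autorewrite with term in E. exact E.
    - assert (E := f_equal (fun v => v ∘ ⟨p2, p1⟩) Es).
      cbn beta in E. autorewrite with term in E. exact E. }
  assert (E' := f_equal (fun v => app (v ∘ p2) p1) E).
  cbn beta in E'. autorewrite with term in E'. exact E'.
Qed.

(* [delay_bind] is the instance [st := dstep D]. *)
Definition delay_fold {A Y : C} (st : hom (later L Y) Y) :
    hom (A ⇒ Y) (delay D A ⇒ Y) :=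
  gfix L ∘ lam (lam (case (dout D ∘ v0)
    (app (wk (wk (wk (idm (A ⇒ Y))))) v0)
    (st ∘ lapp (wk (wk v0)) v0))).

Lemma delay_foldE (A Y G : C) (st : hom (later L Y) Y) (f : hom G (A ⇒ Y)) :
  delay_fold st ∘ f =
  lam (case (dout D ∘ v0)
    (app (wk (wk (wk (idm (A ⇒ Y))))) v0)
    (st ∘ lapp (wk (wk v0)) v0)) ∘ ⟨f, next L ∘ (delay_fold st ∘ f)⟩.
Proof.
  unfold delay_fold. set (c := lam (case _ _ _)).
  rewrite <- (comp_assoc (gfix L)), gfixE at 1. norm. reflexivity.
Qed.

Lemma delay_fold_now (A Y G : C) (st : hom (later L Y) Y) (f : hom G (A ⇒ Y))
    (a : hom G A) :
  app (delay_fold st ∘ f) (now D ∘ a) = app f a.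
Proof.
  rewrite delay_foldE, app_lam_comp. erewrite case_inj1.
  2: { norm. rewrite comp_assoc, dout_now. reflexivity. }
  norm. reflexivity.
Qed.

Lemma delay_fold_step (A Y G : C) (st : hom (later L Y) Y) (f : hom G (A ⇒ Y))
    (d : hom G (later L (delay D A))) :
  app (delay_fold st ∘ f) (dstep D ∘ d)
  = st ∘ ltick (app (delay_fold st ∘ (f ∘ p1)) p2) d.
Proof.
  rewrite delay_foldE, app_lam_comp. erewrite case_inj2.
  2: { norm. rewrite comp_assoc, dout_dstep. reflexivity. }
  norm. reflexivity.
Qed.

(** By [loeb]: on [dstep] both terms apply [st] to delayed recursive calls, and these agree once [t]
    and [u] agree under [next]. *)
Lemma delay_fold_unique (A Y G : C) (st : hom (later L Y) Y)
    (t u : hom G (delay D A ⇒ Y)) :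
  app (t ∘ p1) (now D ∘ p2) = app (u ∘ p1) (now D ∘ p2) ->
  app (t ∘ p1) (dstep D ∘ p2)
  = st ∘ ltick (app (t ∘ (p1 ∘ p1)) p2) p2 ->
  app (u ∘ p1) (dstep D ∘ p2)
  = st ∘ ltick (app (u ∘ (p1 ∘ p1)) p2) p2 ->
  t = u.
Proof.
  intros En Et Eu. apply (@loeb C L). intros H w E.
  apply (f_equal (fun v => v ∘ ⟨w ∘ p1, p2⟩)) in En, Et, Eu.
  cbn beta in *. autorewrite with term in *.
  apply delay_fun_ext; norm; [exact En|].
  rewrite Et, Eu. f_equal.
  (* The delayed recursive calls depend on [v] only through [next L ∘ (v ∘ w)], which is what the
     induction hypothesis [E] equates. *)
  assert (P : forall v : hom G (delay D A ⇒ Y),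
    ltick (app (v ∘ (w ∘ (p1 ∘ p1))) p2) p2
    = lapp (next L ∘ (v ∘ w) ∘ p1) (p2 (A := H) (B := later L (delay D A)))).
  { intros v. norm. reflexivity. }
  rewrite !P, E. reflexivity.
Qed.

End Delay.

(** * The homomorphic extension into a GSD-algebra *)

Section Algebra.
Context {C : set_category} {L : later_modality C} {S : C} (Y : gsd_algebra L S).

(** The law for nested lookups, put in the form with explicit abstractions that normalised terms
    have. *)
Lemma lookup_lam_lookup_lam (G : C) (t : hom (G × S × S) Y) :
  lookup (ops Y) ∘ lam (lookup (ops Y) ∘ lam t)
  = lookup (ops Y) ∘ lam (t ∘ ⟨idm (G × S), p2⟩).
Proof.
  assert (E := lookup_lookup (laws Y) (lam (lam t))).
  unfold wk, v0 in E. autorewrite with term in E. exact E.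
Qed.

Lemma lookup_lam_update (G : C) (y : hom G Y) :
  lookup (ops Y) ∘ lam (app (update (ops Y) ∘ (y ∘ p1)) p2) = y.
Proof.
  rewrite (comp_assoc (update _)), lam_app. apply (lookup_update (laws Y)).
Qed.

(** Since y = lookup (λs. update y s), the left side is lookup (λs. lookup (λs'. update y s')),
    which collapses on the diagonal to lookup (λs. update y s) = y. *)
Lemma lookup_const (G : C) (y : hom G Y) : lookup (ops Y) ∘ lam (y ∘ p1) = y.
Proof.
  assert (E := lookup_lam_lookup_lam (app (update (ops Y) ∘ (y ∘ (p1 ∘ p1))) p2)).
  assert (E' := lookup_lam_update (y ∘ (p1 (B := S)))).
  autorewrite with term in E, E'. rewrite E', lookup_lam_update in E. exact E.
Qed.

Lemma update_lookup_lam (G : C) (t : hom (G × S) Y) (s : hom G S) :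
  app (update (ops Y) ∘ (lookup (ops Y) ∘ lam t)) s
  = app (update (ops Y) ∘ (t ∘ ⟨idm G, s⟩)) s.
Proof. rewrite (update_lookup (laws Y)). norm. reflexivity. Qed.

Lemma step_lookup_lam (G A : C) (t : hom (G × A × S) Y) (x : hom G (later L A)) :
  step (ops Y) ∘ ltick (lookup (ops Y) ∘ lam t) x
  = lookup (ops Y) ∘ lam (step (ops Y) ∘
      ltick (t ∘ ⟨⟨p1 ∘ p1, p2⟩, p2 ∘ p1⟩) (x ∘ p1)).
Proof.
  assert (E := step_lookup (laws Y) (ltick (lam t) x)).
  unfold wk, v0 in E. autorewrite with term in E. exact E.
Qed.

Lemma update_step_ltick (G A : C) (t : hom (G × A) Y) (x : hom G (later L A))
    (s : hom G S) :
  app (update (ops Y) ∘ (step (ops Y) ∘ ltick t x)) s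
  = step (ops Y) ∘ ltick (app (update (ops Y) ∘ t) (s ∘ p1)) x.
Proof. rewrite (update_step (laws Y)). norm. reflexivity. Qed.

Context (D : guarded_delay L) {X : C}.

(* λ(s, x). update (f x) s *)
Definition run_value {G : C} (f : hom G (X ⇒ Y)) : hom G (S × X ⇒ Y) :=
  lam (app (update (ops Y) ∘ app (f ∘ p1) (p2 ∘ p2)) (p1 ∘ p2)).

Definition run_delay {G : C} (f : hom G (X ⇒ Y)) : hom G (delay D (S × X) ⇒ Y) :=
  delay_fold D (step (ops Y)) ∘ run_value f.

(* λm. lookup (λs. run_delay f (m s)) *)
Definition gsd_extend {G : C} (f : hom G (X ⇒ Y)) : hom G ((S ⇒ delay D (S × X)) ⇒ Y) :=
  lam (lookup (ops Y) ∘ lam (app (run_delay f ∘ (p1 ∘ p1)) (app (p2 ∘ p1) p2))).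

Lemma run_delay_comp (G H : C) (f : hom G (X ⇒ Y)) (w : hom H G) :
  run_delay f ∘ w = run_delay (f ∘ w).
Proof. unfold run_delay, run_value. norm. reflexivity. Qed.

Hint Rewrite run_delay_comp : term.

Lemma run_delay_now (G : C) (f : hom G (X ⇒ Y)) (a : hom G (S × X)) :
  app (run_delay f) (now D ∘ a) = app (update (ops Y) ∘ app f (p2 ∘ a)) (p1 ∘ a).
Proof.
  unfold run_delay. rewrite delay_fold_now. unfold run_value. norm. reflexivity.
Qed.

Lemma run_delay_step (G : C) (f : hom G (X ⇒ Y))
    (d : hom G (later L (delay D (S × X)))) :
  app (run_delay f) (dstep D ∘ d)
  = step (ops Y) ∘ ltick (app (run_delay (f ∘ p1)) p2) d.
Proof.
  rewrite <- run_delay_comp. unfold run_delay. rewrite delay_fold_step, <- !comp_assoc.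
  reflexivity.
Qed.

(* Every value of [run_delay f] has already fixed the state. *)
Lemma update_run_delay (G : C) (f : hom G (X ⇒ Y)) (d : hom G (delay D (S × X)))
    (s : hom G S) :
  app (update (ops Y) ∘ app (run_delay f) d) s = app (run_delay f) d.
Proof.
  (* As functions of [d], both sides satisfy the same recursion: [update_update] gives the [now]
     case and [update_step] the [dstep] case. *)
  assert (E : lam (app (update (ops Y) ∘ app (run_delay (f ∘ p1)) p2) (s ∘ p1))
              = run_delay f).
  { apply (delay_fold_unique (st := step (ops Y))); norm.
    - rewrite run_delay_now. apply (update_update (laws Y)).
    - rewrite run_delay_step, update_step_ltick. norm. reflexivity.
    - rewrite run_delay_step. norm. reflexivity. }
  rewrite <- E at 2. norm. reflexivity.
Qed.

Lemma gsd_extend_comp (G H : C) (f : hom G (X ⇒ Y)) (w : hom H G) :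
  gsd_extend f ∘ w = gsd_extend (f ∘ w).
Proof. unfold gsd_extend. norm. reflexivity. Qed.

Hint Rewrite gsd_extend_comp : term.

Lemma app_gsd_extend (G : C) (f : hom G (X ⇒ Y)) (m : hom G (S ⇒ delay D (S × X))) :
  app (gsd_extend f) m
  = lookup (ops Y) ∘ lam (app (run_delay (f ∘ p1)) (app (m ∘ p1) p2)).
Proof. unfold gsd_extend. norm. reflexivity. Qed.

Lemma gsd_extend_extends (G : C) (f : hom G (X ⇒ Y)) :
  is_gsd_extension (state_delay_ops D S X) (state_delay_ret D S X) (ops Y) f
    (gsd_extend f).
Proof.
  split; [split|]; cbn [lookup update step state_delay_ops];
    unfold state_delay_ret, state_delay in *; intros H w.
  - intros g. norm. rewrite !app_gsd_extend. norm. rewrite lookup_lam_lookup_lam.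
    norm. reflexivity.
  (* With r = [run_delay (f ∘ w)], the left side is the lookup of the constant function r (x s). The
     right side reduces to update (r (x s)) s, where the update is absorbed. *)
  - intros x s. norm. rewrite !app_gsd_extend. norm.
    rewrite update_lookup_lam. norm. rewrite update_run_delay.
    assert (E := lookup_const (app (run_delay (f ∘ w)) (app x s))).
    autorewrite with term in E. exact E.
  - intros x. norm. rewrite !app_gsd_extend. norm.
    rewrite run_delay_step, step_lookup_lam. norm. reflexivity.
  - intros x. norm. rewrite app_gsd_extend. norm.
    rewrite run_delay_now. norm.
    assert (E := lookup_lam_update (app (f ∘ w) x)).
    autorewrite with term in E. exact E.
Qed.

Lemma gsd_extend_unique (G : C) (f : hom G (X ⇒ Y))
    (h : hom G ((S ⇒ delay D (S × X)) ⇒ Y)) :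
  is_gsd_extension (state_delay_ops D S X) (state_delay_ret D S X) (ops Y) f h ->
  gsd_extend f = h.
Proof.
  intros [[Hl Hu Hs] He]. cbn [lookup update step state_delay_ops] in *.
  unfold state_delay_ret, state_delay, wk, v0 in *.
  (* On constant functions [h] is forced to be [run_delay f]. *)
  assert (E : run_delay f = lam (app (h ∘ p1) (lam (p2 ∘ p1)))).
  { apply (delay_fold_unique (st := step (ops Y))); norm.
    - rewrite run_delay_now. norm.
      (* The constant function λs'. now (s, x) is update (η x) s. *)
      assert (E := Hu _ p1 (lam (now D ∘ ⟨p2, p2 ∘ (p2 ∘ p1)⟩)) (p1 ∘ p2)).
      specialize (He (G × (S × X)) p1 (p2 ∘ p2)). autorewrite with term in E, He.
      rewrite E, He. reflexivity.
    - rewrite run_delay_step. norm. reflexivity.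
    (* The constant function at [dstep d] is the [step] of the delayed constant functions at [d]. *)
    - assert (E := Hs _ p1 (ltick (lam (p2 ∘ p1)) (p2 (A := G)))).
      autorewrite with term in E. rewrite <- E. reflexivity. }
  apply lam_ext. norm. rewrite app_gsd_extend. norm.
  rewrite <- run_delay_comp, E. norm.
  (* The argument p2 is lookup (λs. λs'. p2 s). *)
  assert (K := Hl _ p1 (lam (lam (app (p2 ∘ (p1 ∘ p1)) (p2 ∘ p1))))).
  autorewrite with term in K. symmetry. exact K.
Qed.

End Algebra.

(** * Freeness and the monad laws *)

Section StateDelayMonad.
Context {C : set_category} {L : later_modality C} (D : guarded_delay L) (S : C).

Lemma state_delay_laws (X : C) : gsd_laws (state_delay_ops D S X).
Proof.
  split; cbn [lookup update step state_delay_ops]; unfold state_delay; intros;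
    norm; reflexivity.
Qed.

Definition state_delay_algebra (X : C) : gsd_algebra L S :=
  GsdAlgebra (state_delay_laws X).

Lemma state_delay_free (X : C) :
  is_free_gsd (state_delay_ops D S X) (state_delay_ret D S X).
Proof.
  split; [apply state_delay_laws|]. intros Y G f. exists (gsd_extend D f).
  split; [apply gsd_extend_extends|]. intros h. apply gsd_extend_unique.
Qed.

Lemma gsd_extension_unique (X G : C) (Y : gsd_algebra L S) (f : hom G (X ⇒ Y))
    (h h' : hom G (state_delay D S X ⇒ Y)) :
  is_gsd_extension (state_delay_ops D S X) (state_delay_ret D S X) (ops Y) f h ->
  is_gsd_extension (state_delay_ops D S X) (state_delay_ret D S X) (ops Y) f h' ->
  h = h'.
Proof.
  intros H H'. rewrite <- (gsd_extend_unique H). apply (gsd_extend_unique H').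
Qed.

(** The ascription matches goals in which [state_delay] has been unfolded to an exponential. *)
Lemma app_state_delay_bind (X Y G : C) (k : hom G (X ⇒ S ⇒ delay D (S × Y)))
    (m : hom G (S ⇒ delay D (S × X))) :
  app ((state_delay_bind D S X Y :
          hom (X ⇒ S ⇒ delay D (S × Y))
              ((S ⇒ delay D (S × X)) ⇒ (S ⇒ delay D (S × Y)))) ∘ k) m
  = lam (app (delay_fold D (dstep D) ∘
        lam (app (app (k ∘ (p1 ∘ p1)) (p2 ∘ p2)) (p1 ∘ p2)))
      (app (m ∘ p1) p2)).
Proof.
  unfold state_delay_bind, state_delay.
  change (@delay_bind C L D ?A ?B) with (delay_fold D (A := A) (dstep D (X := B))).
  norm. reflexivity.
Qed.

Lemma state_delay_bind_extends (X Y G : C) (k : hom G (X ⇒ state_delay D S Y)) :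
  is_gsd_extension (state_delay_ops D S X) (state_delay_ret D S X)
    (state_delay_ops D S Y) k (state_delay_bind D S X Y ∘ k).
Proof.
  split; [split|]; cbn [lookup update step state_delay_ops];
    unfold state_delay_ret, state_delay in *; intros H w; intros; norm;
    rewrite !app_state_delay_bind; norm; try reflexivity.
  (* Normalisation has closed the [lookup] and [update] cases; the [step] case and the generators
     remain. *)
  - rewrite delay_fold_step. norm. reflexivity.
  - rewrite delay_fold_now. apply lam_ext. norm. reflexivity.
Qed.

Lemma is_gsd_hom_comp (A B Y : C) (oA : gsd_ops L S A) (oB : gsd_ops L S B)
    (oY : gsd_ops L S Y) (G : C) (h : hom G (A ⇒ B)) (h' : hom G (B ⇒ Y)) :
  is_gsd_hom oA oB h -> is_gsd_hom oB oY h' ->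
  is_gsd_hom oA oY (lam (app (wk h') (app (wk h) v0))).
Proof.
  intros [Hl Hu Hs] [Hl' Hu' Hs']. unfold wk, v0 in *.
  split; intros H w; intros; norm.
  - rewrite Hl, Hl'. norm. reflexivity.
  - rewrite Hu, Hu'. reflexivity.
  - rewrite Hs, Hs'. norm. reflexivity.
Qed.

Lemma state_delay_is_monad : is_monad (state_delay_monad D S).
Proof.
  split; cbn [monad_ob ret bind state_delay_monad].
  - intros X Y G k x. destruct (state_delay_bind_extends k) as [_ E].
    specialize (E G (idm G) x). rewrite !comp_idr in E. exact E.
  - intros X G m.
    (* Both [bind ret] and the identity extend [ret] to a homomorphism. *)
    assert (E : state_delay_bind D S X X ∘ lam (state_delay_ret D S X ∘ v0)
                = lam (p2 (A := G))).
    { refine (gsd_extension_unique (Y := state_delay_algebra X)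
        (state_delay_bind_extends _) _).
      split; [split|]; intros; cbn [ops state_delay_algebra]; norm; reflexivity. }
    rewrite E. norm. reflexivity.
  - intros X Y Z G k l m.
    (* Both sides are the homomorphic extension of λx. bind l (k x), the left one as a composite of
       homomorphisms. *)
    assert (E : lam (app (wk (state_delay_bind D S Y Z ∘ l))
                      (app (wk (state_delay_bind D S X Y ∘ k)) v0))
      = state_delay_bind D S X Z
        ∘ lam (app (state_delay_bind D S Y Z ∘ wk l) (app (wk k) v0))).
    { refine (gsd_extension_unique (Y := state_delay_algebra Z)
        _ (state_delay_bind_extends _)).
      split.
      - apply (is_gsd_hom_comp (proj1 (state_delay_bind_extends k))
          (proj1 (state_delay_bind_extends l))).
      - intros H w x. destruct (state_delay_bind_extends k) as [_ E].
        assert (K := E H w x). norm. autorewrite with term in K. rewrite K. reflexivity. }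
    rewrite <- E. norm. reflexivity.
Qed.

End StateDelayMonad.

Unset Implicit Arguments.

Theorem theorem4p2 (C : guarded_category) (k : clock C)
    (D : guarded_delay (later_at k)) (S : C) :
  (forall X : C,
     is_free_gsd (state_delay_ops D S X) (state_delay_ret D S X)) /\
  is_free_model_monad (state_delay_monad D S) (state_delay_ops D S).
Proof.
  split; [apply state_delay_free|].
  split; [apply state_delay_is_monad|split; [apply state_delay_free|]].
  intros X Y G f. apply state_delay_bind_extends.
Qed.
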